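(* Let $n\ge 2$. For any $w\in\mathcal{M}_n$, $$l(w)=\rho(\mathbf{x}_w),\qquad\text{where } \mathbf{x}_w:=\lambda_B-w\lambda_B\in\{0,1\}^n .$$ In other words, for any $\mathbf{x}=(x_1,\dots,x_n)\in\{0,1\}^n$, $$\rho(\mathbf{x})=l\bigl(w_{\mathrm{supp}(\mathbf{x})}\bigr),\qquad\text{where } \mathrm{supp}(\mathbf{x})=\{i\mid x_i=1\}.$$
   Context: Let $\epsilon_1,\dots,\epsilon_n$ be the standard basis of $\mathbb{R}^n$ with the standard inner product $(\cdot,\cdot)$. Put $\alpha_1:=\epsilon_1$ and $\alpha_i:=\epsilon_i-\epsilon_{i-1}$ for $2\le i\le n$ (a simple system of type $B_n$). Let $s_i(v):=v-2\frac{(\alpha_i,v)}{(\alpha_i,\alpha_i)}\alpha_i$, and let $W(B_n)$ be the group generated by $s_1,\dots,s_n$. The length $l(w)$ of $w\in W(B_n)$ is the least $r$ such that $w$ is a product of $r$ of the generators $s_1,\dots,s_n$. Put $\lambda_B:=(1/2,\dots,1/2)\in\mathbb{R}^n$. For $J=\{j_1<j_2<\dots<j_t\}\subseteq\{1,\dots,n\}$ let $w_J:=w_{j_1}w_{j_2}\cdots w_{j_t}$ (composition of maps, rightmost applied first), where $w_j:=s_js_{j-1}\cdots s_1$, and $w_\emptyset:=\mathrm{id}$. Let $\mathcal{M}_n:=\{w_J\mid J\subseteq\{1,\dots,n\}\}$ (this is the set of $\lambda_B$-minuscule elements). The moment function is $\rho(x_1,\dots,x_n):=x_1+2x_2+\dots+nx_n$.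 *)

(* Defs.v *)
From mathcomp Require Import all_boot all_order all_algebra.
From mathcomp Require Import boolp classical_sets reals.

Set Implicit Arguments.
Unset Strict Implicit.
Unset Printing Implicit Defensive.

Import Order.TTheory GRing.Theory Num.Theory.
Local Open Scope ring_scope.

(* Vectors of R^n are row vectors, and the coordinates 1, ..., n are numbered
   0, ..., n - 1 by 'I_n. *)

Definition dot (R : realType) (n : nat) (u v : 'rV[R]_n) : R :=
  \sum_(i < n) u 0 i * v 0 i.

Definition eps (R : realType) (n : nat) (i : 'I_n) : 'rV[R]_n := delta_mx 0 i.
Arguments eps R {n} i : assert.

(* ord_pred is cyclic, but here it is only used away from 0, where it is the
   ordinary predecessor. *)
Definition alpha (R : realType) (n : nat) (i : 'I_n) : 'rV[R]_n :=
  if i == 0%N :> nat then eps R i else eps R i - eps R (ord_pred i).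
Arguments alpha R {n} i : assert.

Definition sB (R : realType) (n : nat) (i : 'I_n) (v : 'rV[R]_n) : 'rV[R]_n :=
  v - (2 * (dot (alpha R i) v / dot (alpha R i) (alpha R i))) *: alpha R i.
Arguments sB R {n} i v : assert.

(* compose_seq [:: f1; ...; fr] = f1 \o ... \o fr: the last map is applied first. *)
Definition compose_seq (T : Type) (fs : seq (T -> T)) : T -> T :=
  foldr (fun f g => f \o g) id fs.

Definition transf_group (T : Type) (G : set (T -> T)) : Prop :=
  [/\ G id,
      forall f g, G f -> G g -> G (f \o g) &
      forall f, G f -> exists g, [/\ G g, cancel f g & cancel g f]].

Definition WB (R : realType) (n : nat) : set ('rV[R]_n -> 'rV[R]_n) :=
  smallest (@transf_group 'rV[R]_n) (range (@sB R n)).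

Definition is_product (R : realType) (n : nat) (w : 'rV[R]_n -> 'rV[R]_n)
    (r : nat) : Prop :=
  exists2 u : seq 'I_n, size u = r & w = compose_seq [seq sB R i | i <- u].

(* The value 0 outside WB is a convention; see lengthBP. *)
Definition lengthB (R : realType) (n : nat) (w : 'rV[R]_n -> 'rV[R]_n) : nat :=
  if pselect (exists r, `[< is_product w r >]) is left h then ex_minn h else 0%N.

Definition lambdaB (R : realType) (n : nat) : 'rV[R]_n := const_mx (1 / 2).

(* s_j s_(j-1) ... s_1; enum lists 'I_n in increasing order. *)
Definition wj (R : realType) (n : nat) (j : 'I_n) : 'rV[R]_n -> 'rV[R]_n :=
  compose_seq [seq sB R i | i <- rev [seq i : 'I_n <- enum 'I_n | (i <= j)%N]].
Arguments wj R {n} j _ : assert.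

(* enum J is in increasing order. *)
Definition wJ (R : realType) (n : nat) (J : {set 'I_n}) : 'rV[R]_n -> 'rV[R]_n :=
  compose_seq [seq wj R j | j <- enum J].
Arguments wJ R {n} J _ : assert.

Definition minusculeB (R : realType) (n : nat) : set ('rV[R]_n -> 'rV[R]_n) :=
  range (@wJ R n).

Definition rho (R : realType) (n : nat) (x : 'rV[R]_n) : R :=
  \sum_(i < n) i.+1%:R * x 0 i.

Definition cube01 (R : realType) (n : nat) : set 'rV[R]_n :=
  fun x => forall i, x 0 i = 0 \/ x 0 i = 1.

Definition supp (R : realType) (n : nat) (x : 'rV[R]_n) : {set 'I_n} :=
  [set i | x 0 i == 1].

Section Sanity.
Variables (R : realType) (n : nat).
Implicit Types (w : 'rV[R]_n -> 'rV[R]_n).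

Lemma alpha_first (i : 'I_n) : i = 0%N :> nat -> alpha R i = eps R i.
Proof. by rewrite /alpha => ->. Qed.

Lemma alpha_next (i j : 'I_n) : i = j.+1 :> nat -> alpha R i = eps R i - eps R j.
Proof.
move=> ij; rewrite /alpha ij /=; congr (_ - eps R _).
by apply: val_inj; rewrite /= ij addSn /= modnDr modn_small.
Qed.

Lemma dot_alpha_neq0 (i : 'I_n) : dot (alpha R i) (alpha R i) != 0.
Proof.
have ai : alpha R i 0 i = 1.
  have [i0|i0] := eqVneq (val i) 0%N.
    by rewrite alpha_first// mxE !eqxx.
  have [j ij] : exists j : 'I_n, i = j.+1 :> nat.
    have lt_j : (i.-1 < n)%N by rewrite (leq_ltn_trans (leq_pred _))// ltn_ord.
    by exists (Ordinal lt_j); rewrite /= prednK// lt0n.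
  have /negPf nij : i != j by rewrite -val_eqE /= ij gtn_eqF.
  by rewrite (alpha_next ij) !mxE !eqxx nij subr0.
rewrite /dot (bigD1 i)//= ai mulr1 gt_eqF// ltr_wpDr//.
by apply: sumr_ge0 => j _; rewrite -expr2 sqr_ge0.
Qed.

Lemma dotBr (u v w : 'rV[R]_n) : dot u (v - w) = dot u v - dot u w.
Proof. by rewrite /dot -sumrB; apply: eq_bigr => i _; rewrite !mxE mulrBr. Qed.

Lemma dotZr (u v : 'rV[R]_n) a : dot u (a *: v) = a * dot u v.
Proof. by rewrite /dot mulr_sumr; apply: eq_bigr => i _; rewrite !mxE mulrCA. Qed.

Lemma sBK (i : 'I_n) : involutive (@sB R n i).
Proof.
move=> v; rewrite {1}/sB; set a := alpha R i.
have -> : dot a (sB R i v) / dot a a = - (dot a v / dot a a).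
  rewrite /sB dotBr dotZr -mulrA divfK ?dot_alpha_neq0//.
  by rewrite mulr_natl mulr2n opprD addrA subrr add0r mulNr.
by rewrite mulrN scaleNr opprK /sB subrK.
Qed.

Lemma compose_seq_cat (T : Type) (s t : seq (T -> T)) :
  compose_seq (s ++ t) = compose_seq s \o compose_seq t.
Proof. by elim: s => //= f s ->. Qed.

Lemma compose_WB (fs : seq ('rV[R]_n -> 'rV[R]_n)) :
  (forall k, (k < size fs)%N -> WB (nth id fs k)) -> WB (compose_seq fs).
Proof.
move=> Wfs G [gG sG]; have [G1 GM _] := gG.
elim: fs Wfs => //= f fs IH Wfs; apply: GM; first exact: (Wfs 0%N).
by apply: IH => k; apply: (Wfs k.+1).
Qed.

Lemma sB_WB (i : 'I_n) : WB (@sB R n i).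
Proof. by move=> G [_]; apply; exists i. Qed.

Lemma word_WB (u : seq 'I_n) : WB (compose_seq [seq sB R i | i <- u]).
Proof.
apply: compose_WB => k; rewrite size_map => ku.
by case: u ku => // i0 u ku; rewrite (nth_map i0)//; apply: sB_WB.
Qed.

Lemma WB_word w : WB w <-> exists r, is_product w r.
Proof.
split=> [|[r [u _ ->]]]; last exact: word_WB.
apply: (smallest_sub (X := fun w => exists r, is_product w r)).
- split.
  + by exists 0%N, [::].
  + move=> f g [_ [u _ ->]] [_ [v _ ->]]; exists (size (u ++ v)), (u ++ v) => //.
    by rewrite map_cat compose_seq_cat.
  + move=> f [_ [u _ ->]].
    exists (compose_seq [seq sB R i | i <- rev u]); split.
    * by exists (size (rev u)), (rev u).
    * elim: u => // i u IH v; rewrite rev_cons -cats1 map_cat compose_seq_cat /=.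
      by rewrite sBK IH.
    * elim: u => // i u IH v; rewrite rev_cons -cats1 map_cat compose_seq_cat /=.
      by rewrite IH sBK.
- by move=> _ [i _ <-]; exists 1%N, [:: i].
Qed.

Lemma lengthBP w : WB w ->
  is_product w (lengthB w) /\ forall r, is_product w r -> (lengthB w <= r)%N.
Proof.
move=> /WB_word [r wr]; rewrite /lengthB; case: pselect => [h|[]]; last first.
  by exists r; apply/asboolP.
case: ex_minnP => m /asboolP wm min; split=> // k wk; apply: min.
exact/asboolP.
Qed.

Lemma minusculeB_WB w : minusculeB w -> WB w.
Proof.
move=> [J _ <-]; apply: compose_WB => k; rewrite size_map => kJ.
case: (enum J) kJ => // j0 s kJ; rewrite (nth_map j0)//; exact: word_WB.
Qed.

End Sanity.

(* Main.v *)
Require Import Defs.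
From mathcomp Require Import all_boot all_order all_algebra.
From mathcomp Require Import boolp classical_sets reals.
From mathcomp Require Import lra.
Import Order.TTheory GRing.Theory Num.Theory.
Local Open Scope ring_scope.

(** Every simple root has moment 1, so a simple reflection lowers the moment of
    [v] by the coefficient [2 (alpha_i, v) / (alpha_i, alpha_i)]. On the cube
    [|v_k| <= 1/2], which the reflections preserve, this coefficient is at most 1,
    whence [rho (lambda - w lambda) <= l(w)]. Conversely, along the defining word
    of [w_J] every letter subtracts exactly its simple root, so that
    [lambda - w_J lambda] is the indicator vector of [J], and that word has
    length [rho (lambda - w_J lambda)]. *)

Set Implicit Arguments.
Unset Strict Implicit.

Section Moment.
Variables (R : realType) (n : nat).
Implicit Types (u v : 'rV[R]_n) (i j k : 'I_n).

Lemma dot_epsl i v : dot (eps R i) v = v 0 i.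
Proof.
rewrite /dot (bigD1 i)//= big1 ?addr0 => [|j ji]; rewrite mxE ?eqxx ?mul1r//.
by rewrite (negPf ji) mul0r.
Qed.

Lemma dotBl u v w : dot (u - v) w = dot u w - dot v w.
Proof. by rewrite /dot -sumrB; apply: eq_bigr => i _; rewrite !mxE mulrBl. Qed.

Lemma ord_predecessor i : i != 0%N :> nat -> exists j : 'I_n, i = j.+1 :> nat.
Proof.
move=> i0; have lt_j : (i.-1 < n)%N by rewrite (leq_ltn_trans (leq_pred _)).
by exists (Ordinal lt_j); rewrite /= prednK// lt0n.
Qed.

Lemma sB_first i v : i = 0%N :> nat -> sB R i v = v - (2 * v 0 i) *: eps R i.
Proof.
by move=> i0; rewrite /sB alpha_first// !dot_epsl mxE !eqxx divr1.
Qed.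

Lemma sB_next i j v : i = j.+1 :> nat ->
  sB R i v = v - (v 0 i - v 0 j) *: (eps R i - eps R j).
Proof.
move=> ij; have nij : (i == j) = false by rewrite -val_eqE /= ij gtn_eqF.
rewrite /sB (alpha_next R ij) !dotBl !dot_epsl !mxE !eqxx nij [j == i]eq_sym nij /=.
(* The squared length of the long root is 2, which cancels the factor 2 of the reflection. *)
have -> : 1%:R - 0%:R - (0%:R - 1%:R) = 2 :> R by lra.
by rewrite mulrC divfK// pnatr_eq0.
Qed.

Lemma rhoB u v : rho (u - v) = rho u - rho v.
Proof. by rewrite /rho -sumrB; apply: eq_bigr => i _; rewrite !mxE mulrBr. Qed.

Lemma rhoZ a v : rho (a *: v) = a * rho v.
Proof. by rewrite /rho mulr_sumr; apply: eq_bigr => i _; rewrite mxE mulrCA. Qed.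

Lemma rho_sum (s : seq 'I_n) (f : 'I_n -> 'rV[R]_n) :
  rho (\sum_(j <- s) f j) = \sum_(j <- s) rho (f j).
Proof.
rewrite /rho exchange_big; apply: eq_bigr => i _.
by rewrite summxE mulr_sumr.
Qed.

Lemma rho_eps i : rho (eps R i) = i.+1%:R.
Proof.
rewrite /rho (bigD1 i)//= big1 ?addr0 => [|j ji]; rewrite mxE ?eqxx ?mulr1//.
by rewrite (negPf ji) mulr0.
Qed.

(** The first reflection negates one coordinate and every other one swaps two adjacent
    coordinates. *)
Lemma sB_cube i v : (forall k, `|v 0 k| <= 1 / 2) ->
  forall k, `|sB R i v 0 k| <= 1 / 2.
Proof.
move=> v_le k; have [i0|/ord_predecessor[j ij]] := eqVneq (i : nat) 0%N.
  rewrite sB_first// !mxE /=; case: eqVneq => [->|_] /=; last first.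
    by rewrite mulr0 subr0.
  by rewrite mulr1 mulr_natl mulr2n opprD addrA subrr add0r normrN.
rewrite (sB_next _ ij) !mxE /=; case: eqVneq => [->|_] /=.
  have -> : (i == j) = false by rewrite -val_eqE /= ij gtn_eqF.
  by rewrite subr0 mulr1 opprB addrC subrK.
case: eqVneq => [->|_] /=; last by rewrite subrr mulr0 subr0.
by rewrite sub0r mulrN1 opprK addrC subrK.
Qed.

Lemma rho_sB_le i v : (forall k, `|v 0 k| <= 1 / 2) ->
  rho v - rho (sB R i v) <= 1.
Proof.
move=> v_le; have [i0|/ord_predecessor[j ij]] := eqVneq (i : nat) 0%N.
  rewrite sB_first// rhoB rhoZ rho_eps i0 mulr1.
  by have := v_le i; rewrite ler_norml; lra.
rewrite (sB_next _ ij) rhoB rhoZ rhoB !rho_eps ij -[j.+2%:R]natr1.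
by have := v_le i; have := v_le j; rewrite !ler_norml; lra.
Qed.

Lemma rho_word_le (u : seq 'I_n) v : (forall k, `|v 0 k| <= 1 / 2) ->
  rho (v - compose_seq [seq sB R i | i <- u] v) <= (size u)%:R.
Proof.
(* The cube bound is carried through the induction, since each new letter acts on an intermediate
   vector. *)
move=> v_le; have [] // : (forall k,
    `|compose_seq [seq sB R i | i <- u] v 0 k| <= 1 / 2) /\
    rho (v - compose_seq [seq sB R i | i <- u] v) <= (size u)%:R.
elim: u => [|i u [cube_u rho_u]] /=.
  (* The zero vector is written [0 *: 0], so that homogeneity gives its moment. *)
  by split=> //; rewrite subrr -(scale0r 0) rhoZ mul0r.
split; first exact: sB_cube.
by move: rho_u (rho_sB_le i cube_u); rewrite !rhoB -natr1; lra.
Qed.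

(** As [val] is injective, the letters of [wj] can be compared and counted inside [iota]. *)
Lemma filter_enum_ord_leq j :
  [seq val i | i <- enum 'I_n & (i <= j)%N] = iota 0 j.+1.
Proof.
have := filter_map (@nat_of_ord n) (fun m => m <= j)%N (enum 'I_n).
rewrite val_enum_ord /= => <-; exact: (filter_iota_leq 0 (ltn_ord j)).
Qed.

Lemma wj_first j v : j = 0%N :> nat -> wj R j v = sB R j v.
Proof.
move=> j0; rewrite /wj.
have -> // : [seq i : 'I_n <- enum 'I_n | (i <= j)%N] = [:: j].
by apply: (inj_map val_inj); rewrite filter_enum_ord_leq /= j0.
Qed.

Lemma wj_next i j v : i = j.+1 :> nat -> wj R i v = sB R i (wj R j v).
Proof.
move=> ij; rewrite /wj.
have -> : [seq k : 'I_n <- enum 'I_n | (k <= i)%N]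
        = rcons [seq k : 'I_n <- enum 'I_n | (k <= j)%N] i.
  apply: (inj_map val_inj); rewrite map_rcons !filter_enum_ord_leq [val i]ij ij.
  by rewrite -cats1 -[j.+2]addn1 iotaD.
by rewrite rev_rcons.
Qed.

(** The subtracted simple roots telescope: once [eps R j] is removed, coordinates [j] and [j.+1] are
    -1/2 and 1/2, and the next reflection swaps them, which moves the defect one place up. *)
Lemma wj_sub_eps j v : (forall k, (k <= j)%N -> v 0 k = 1 / 2) ->
  wj R j v = v - eps R j.
Proof.
case: j => m; elim: m => [|m IH] lt_m v_half.
  rewrite wj_first// sB_first// v_half//.
  by rewrite mulrC divfK ?scale1r// pnatr_eq0.
pose j := Ordinal (ltnW lt_m); set i := Ordinal lt_m.
have ij : i = j.+1 :> nat by [].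
have nij : (i == j) = false by rewrite -val_eqE /= gtn_eqF.
rewrite (wj_next _ ij) IH => [|k km]; last by apply: v_half; rewrite ltnW.
rewrite (sB_next _ ij) !mxE !eqxx nij /= !v_half//=.
have -> : 1 / 2 - 0 - (1 / 2 - 1) = 1 :> R by lra.
by rewrite scale1r opprB addrA subrK.
Qed.

(** The factors with larger indices act first and change only coordinates above [j], so all
    coordinates up to [j] still equal 1/2 when [wj R j] acts. *)
Lemma compose_wj_sorted (s : seq 'I_n) : sorted ltn (map val s) ->
  compose_seq [seq wj R j | j <- s] (lambdaB R n)
  = lambdaB R n - \sum_(j <- s) eps R j.
Proof.
elim: s => [|j s IH] /=; first by rewrite big_nil subr0.
rewrite (path_sortedE ltn_trans) => /andP[/allP j_lt s_sorted].
rewrite IH// big_cons wj_sub_eps => [|k kj].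
  by rewrite opprD addrA addrAC.
rewrite !mxE summxE big_seq big1 ?subr0// => l ls; rewrite mxE.
suff /negPf-> : k != l by [].
by rewrite -val_eqE neq_ltn (leq_ltn_trans kj (j_lt _ (map_f val ls))).
Qed.

Lemma sorted_enum_set (J : {set 'I_n}) : sorted ltn (map val (enum J)).
Proof.
rewrite {1}/enum_mem -enumT; apply: (subseq_sorted ltn_trans (s2 := iota 0 n)).
  by rewrite -val_enum_ord map_subseq// filter_subseq.
exact: iota_ltn_sorted.
Qed.

Lemma lambdaB_sub_wJ (J : {set 'I_n}) :
  lambdaB R n - wJ R J (lambdaB R n) = \sum_(j in J) eps R j.
Proof.
by rewrite /wJ compose_wj_sorted ?sorted_enum_set// opprB addrC subrK big_enum.
Qed.

Lemma sum_eps_coord (J : {set 'I_n}) k :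
  (\sum_(j in J) eps R j) 0 k = (k \in J)%:R.
Proof.
rewrite summxE; have [kJ|kJ] := boolP (k \in J).
  rewrite (bigD1 k)//= mxE !eqxx big1 ?addr0// => j /andP[_ jk].
  by rewrite mxE eq_sym (negPf jk).
rewrite big1// => j jJ; rewrite mxE /=; case: eqVneq => // kj.
by rewrite kj jJ in kJ.
Qed.

(** Concatenating the defining words gives this length; as indices start at 0, [wj R j] has [j.+1]
    letters. *)
Lemma wJ_word (J : {set 'I_n}) : is_product (wJ R J) (\sum_(j in J) j.+1)%N.
Proof.
rewrite /wJ -big_enum /=; elim: (enum J) => [|j s [u su w_u]] /=.
  by exists [::]; rewrite ?big_nil.
exists (rev [seq i : 'I_n <- enum 'I_n | (i <= j)%N] ++ u).
  rewrite size_cat size_rev su big_cons; congr (_ + _)%N.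
  by rewrite -(size_map val) filter_enum_ord_leq size_iota.
by rewrite w_u map_cat compose_seq_cat.
Qed.

Lemma lengthB_wJ (J : {set 'I_n}) :
  (lengthB (wJ R J))%:R = rho (lambdaB R n - wJ R J (lambdaB R n)).
Proof.
have [|[u <- w_u] min] := @lengthBP R n (wJ R J).
  by apply: minusculeB_WB; exists J.
apply: le_anti; apply/andP; split.
  (* Upper bound on the length, from the defining word. *)
  rewrite lambdaB_sub_wJ -big_enum rho_sum big_enum /=.
  under eq_bigr do rewrite rho_eps.
  by rewrite -natr_sum ler_nat; apply: min; exact: wJ_word.
(* Lower bound, from a shortest word [u]; [lambdaB R n] lies in the cube. *)
rewrite w_u; apply: rho_word_le => k.
by rewrite mxE ger0_norm// divr_ge0// ler0n.
Qed.

End Moment.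

Theorem theorem3p4 (R : realType) (n : nat) (hn : (2 <= n)%N) :
  (forall w : 'rV[R]_n -> 'rV[R]_n, minusculeB w ->
     cube01 (lambdaB R n - w (lambdaB R n)) /\
     (lengthB w)%:R = rho (lambdaB R n - w (lambdaB R n))) /\
  (forall x : 'rV[R]_n, cube01 x -> rho x = (lengthB (wJ R (supp x)))%:R).
Proof.
split=> [_ [J _ <-]|x x01].
  split; last exact: lengthB_wJ.
  move=> k; rewrite lambdaB_sub_wJ sum_eps_coord.
  by case: (k \in J); [right|left].
(* A 0-1 vector is the indicator of its support. *)
rewrite lengthB_wJ lambdaB_sub_wJ; congr rho; apply/rowP => k.
rewrite sum_eps_coord inE; case: (x01 k) => ->; rewrite ?eqxx//.
by rewrite eq_sym oner_eq0.
Qed.
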